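(* Let $k\geq 3$ and let $\Gamma_k'$ be the marked group $(\mathbb{Z},\{\pm 2,\pm 3,\ldots,\pm(2k-3)\})$. Then $\chi_B(F(2^{\Gamma_k'}))=k$.
   Context: A marked group is a finitely generated group $\Gamma$ with a finite symmetric generating set $S$ not containing the identity. The left shift action of $\Gamma$ on $2^\Gamma$ is $(g\cdot x)(h)=x(g^{-1}h)$; its free part is $F(2^\Gamma)=\{x\in 2^\Gamma : g\cdot x\neq x \text{ for all } g\neq \mathrm{id}\}$. The shift graph $F(2^\Gamma)$ is the graph on this free part joining distinct $x,y$ iff $s\cdot x=y$ for some $s\in S$. $\chi_B(G)$ denotes the Borel chromatic number: the least $k$ such that there is a Borel map $c$ from the vertex set to a $k$-element set with $c(x)\neq c(y)$ for adjacent $x,y$. *)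

(* Defs.v *)
From HB Require Import structures.
From mathcomp Require Import all_boot all_order all_algebra.
From mathcomp Require Import all_classical.
From mathcomp Require Import topology measure.
From mathcomp Require Import zify.

Set Implicit Arguments.
Unset Strict Implicit.
Unset Printing Implicit Defensive.

Import Order.TTheory GRing.Theory Num.Theory.

Local Open Scope classical_set_scope.

Section Generation.
Local Open Scope group_scope.

Definition generates (G : groupType) (S : set G) : Prop :=
  forall H : set G,
    H 1 -> (forall g h, H g -> H h -> H (g * h)) ->
    (forall g, H g -> H g^-1) -> S `<=` H -> forall g, H g.

Record markedGroup := MarkedGroup {
  mg_group :> groupType;
  mg_gens : set mg_group;
  mg_gens_finite : finite_set mg_gens;
  mg_gens_sym : forall s, mg_gens s -> mg_gens s^-1;
  mg_gens_non1 : ~ mg_gens 1;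
  mg_gens_generate : generates mg_gens
}.

End Generation.

Record topGraph := TopGraph {
  vertex : topologicalType;
  adj : vertex -> vertex -> Prop;
  adj_sym : forall x y, adj x y -> adj y x;
  adj_irr : forall x, ~ adj x x
}.

Definition borel_set (X : topologicalType) : set (set X) := <<s @open X >>.

Definition borel_colorable (G : topGraph) (n : nat) : Prop :=
  exists c : vertex G -> 'I_n,
    (forall A : set 'I_n, borel_set (c @^-1` A)) /\
    (forall x y, adj x y -> c x <> c y).

(* chi_B(G) = n; a predicate, since a Borel graph need not have any finite
   Borel coloring. *)
Definition borel_chromatic_number (G : topGraph) (n : nat) : Prop :=
  borel_colorable G n /\ forall m, borel_colorable G m -> (n <= m)%N.

Section Shift.
Local Open Scope group_scope.

Definition shift (G : groupType) (g : G) (x : {ptws G -> bool}) :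
    {ptws G -> bool} :=
  fun h => x (g^-1 * h).

Definition free_part (G : groupType) : set {ptws G -> bool} :=
  [set x | forall g : G, g <> 1 -> shift g x <> x].
#[global] Arguments free_part : clear implicits.

Lemma shift1 (G : groupType) (x : {ptws G -> bool}) : shift 1 x = x.
Proof. by apply/funext => h; rewrite /shift invg1 mul1g. Qed.

Lemma shiftM (G : groupType) (g h : G) (x : {ptws G -> bool}) :
  shift (g * h) x = shift g (shift h x).
Proof. by apply/funext => a; rewrite /shift invgM mulgA. Qed.

(* The set is coerced to its subtype, which carries the subspace topology. *)
Definition shift_adj (M : markedGroup) (x y : free_part M) : Prop :=
  x <> y /\ exists2 s : M, mg_gens s & shift s (set_val x) = set_val y.

Lemma shift_adj_sym (M : markedGroup) (x y : free_part M) :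
  shift_adj x y -> shift_adj y x.
Proof.
move=> [neq [s Ss sxy]]; split; first by move=> e; apply: neq.
exists s^-1; first exact: mg_gens_sym.
by rewrite -sxy -shiftM mulVg shift1.
Qed.

Lemma shift_adj_irr (M : markedGroup) (x : free_part M) : ~ shift_adj x x.
Proof. by case. Qed.

Definition shift_graph (M : markedGroup) : topGraph :=
  TopGraph (@shift_adj_sym M) (@shift_adj_irr M).

End Shift.

Section GammaPrime.
Local Open Scope ring_scope.

(* The additive group of int, as a groupType. *)
Definition Zgrp : groupType := Algebra.to_multiplicative int.

Definition Gamma'_gens (k : nat) : set Zgrp :=
  [set s : int | 2 <= `|s| <= 2 * k%:Z - 3].

Lemma Gamma'_gens_finite k : finite_set (Gamma'_gens k).
Proof.
apply: (@sub_finite_set _ _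
  [set` map Posz (iota 0 (2 * k)) ++ map (fun n : nat => - n%:Z) (iota 0 (2 * k))]);
  last exact: finite_seq.
move=> s /andP[_ hs]; rewrite /= mem_cat; apply/orP.
have [n_ge|n_lt] := leP 0 (s : int); [left|right]; apply/mapP;
  exists `|(s : int)|%N; rewrite ?mem_iota; lia.
Qed.

Lemma Gamma'_gens_sym k s : Gamma'_gens k s -> Gamma'_gens k s^-1%g.
Proof. by move=> hs; rewrite /Gamma'_gens /= (normrN (s : int)). Qed.

Lemma Gamma'_gens_non1 k : ~ Gamma'_gens k 1%g.
Proof. by move=> /andP[]. Qed.

Lemma Gamma'_gens_generate k : (3 <= k)%N -> generates (Gamma'_gens k).
Proof.
move=> hk H H1 HM HV sH g.
have Hone : H (1 : int).
  have H3 : H (3 : int) by apply: sH; rewrite /Gamma'_gens /=; lia.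
  have H2 : H (2 : int) by apply: sH; rewrite /Gamma'_gens /=; lia.
  exact: (HM _ _ H3 (HV _ H2)).
have Hn (n : nat) : H n%:Z.
  elim: n => [//|n IH]; have := HM _ _ Hone IH.
  by rewrite -[n.+1]add1n PoszD.
case: g => n; first exact: Hn.
by rewrite NegzE; exact: (HV _ (Hn n.+1)).
Qed.

Definition Gamma' (k : nat) (hk : (3 <= k)%N) : markedGroup :=
  MarkedGroup (@Gamma'_gens_finite k) (@Gamma'_gens_sym k)
    (@Gamma'_gens_non1 k) (Gamma'_gens_generate hk).

End GammaPrime.

(* Main.v *)
Require Import Defs.
From mathcomp Require Import all_boot all_order all_algebra.
From mathcomp Require Import all_classical.
From mathcomp Require Import topology measure.
From mathcomp Require Import zify.

Set Implicit Arguments.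
Unset Strict Implicit.
Unset Printing Implicit Defensive.

Import Order.TTheory GRing.Theory Num.Theory.

Local Open Scope ring_scope.

(** Lower bound: on a single orbit a proper coloring with fewer than [k] colors
    must give neighbors [b], [b + 1] the same color, since otherwise
    [b - 2(k-2), ..., b - 2, b, b + 1] would carry [k] distinct colors; but then
    [b] and [b + 2] agree.
    Upper bound: if the orbit is cut into pieces of lengths [2k-1] and [2k],
    coloring each point by half its distance to the end of its piece is proper.
    Such a cut is Borel: a greedy choice along countably many finite patterns
    gives a Borel maximal discrete marker set, whose gaps are long enough to be
    subdivided into pieces of these two lengths. *)

(** * Colorings of the integers *)

Lemma coloring_neighbors_eq (k m : nat) (c : int -> 'I_m) :
  (3 <= k)%N ->
  (forall i j : int, 2 <= j - i <= 2 * k%:Z - 3 -> c i <> c j) ->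
  (m < k)%N -> forall b, c b = c (b + 1).
Proof.
move=> hk hc hm b; apply: contrapT => neq.
pose p (i : 'I_k) : int :=
  if (i.+1 < k)%N then b + 2 * i%:Z - 2 * k%:Z + 4 else b + 1.
have inj : injective (c \o p).
  suff H (i j : 'I_k) : (i < j)%N -> c (p i) <> c (p j).
    move=> i j /= e; apply/val_inj; case: (ltngtP i j) => // [|] /H.
      by rewrite e.
    by rewrite e.
  move=> ij; have ltj := ltn_ord j.
  rewrite /p (_ : (i.+1 < k)%N); last by lia.
  case: ltnP => hj; first by apply: hc; lia.
  (* Only [b] and [b + 1] are too close to be adjacent; [neq] separates that pair. *)
  have [e|ne] := eqVneq i.+2 k; last by apply: hc; lia.
  by rewrite (_ : b + 2 * i%:Z - 2 * k%:Z + 4 = b)//; lia.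
by have := leq_card _ inj; rewrite !card_ord; lia.
Qed.

Lemma coloring_size_ge (k m : nat) (c : int -> 'I_m) :
  (3 <= k)%N ->
  (forall i j : int, 2 <= j - i <= 2 * k%:Z - 3 -> c i <> c j) ->
  (k <= m)%N.
Proof.
move=> hk hc; rewrite leqNgt; apply/negP => hm.
have e := coloring_neighbors_eq hk hc hm.
apply: (hc 0 2); first by lia.
by rewrite e e.
Qed.

(** * Countdown labelings and cut intervals *)

(** Think of [g i] as the distance from [i] to the last point of its piece; restarting at [2k - 2]
    or more means pieces of length at least [2k - 1]. *)
Definition countdown (k : nat) (g : int -> nat) : Prop :=
  forall i, if (0 < g i)%N then g (i + 1) = (g i).-1
            else (2 * k - 2 <= g (i + 1)%R)%N.

Lemma countdown_sub k g : countdown k g ->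
  forall (j : nat) i, (j <= g i)%N -> g (i + j%:Z) = (g i - j)%N.
Proof.
move=> hg; elim=> [|j IH] i hj; first by rewrite addr0 subn0.
have := hg (i + j%:Z); rewrite IH; last by lia.
by rewrite subn_gt0 hj (_ : i + j%:Z + 1 = i + j.+1%:Z); [move->|]; lia.
Qed.

(** Within one piece the labels differ by [j], at least 2. Otherwise the next piece starts at
    [2k - 2] or more and loses [j - g i - 1], so the label at [i + j] still exceeds [g i] by at
    least 2. *)
Lemma countdown_half_neq k g : countdown k g ->
  forall (j : nat) i, (2 <= j <= 2 * k - 3)%N ->
  (g i)./2 <> (g (i + j%:Z))./2.
Proof.
move=> hg j i hj; have [le|lt] := leqP j (g i).
  by rewrite (countdown_sub hg)//; lia.
have := hg (i + (g i)%:Z); rewrite (countdown_sub hg)// subnn ltnn => h.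
have := @countdown_sub k g hg (j - (g i).+1) (i + (g i)%:Z + 1).
rewrite (_ : _ + _ + 1 + _ = i + j%:Z); last by lia.
by move=> ->; lia.
Qed.

(* An interval of length [L = q (2k-1) + r] with [r <= q] is cut, from the left,
   into [r] pieces of length [2k] and then [q - r] pieces of length [2k-1];
   [cut_dist k L d] is the distance from position [d] to the last point of its
   piece. *)
Definition cut_dist (k L d : nat) : nat :=
  let r := (L %% (2 * k - 1))%N in
  if (d < 2 * k * r)%N then (2 * k - 1 - d %% (2 * k))%N
  else (2 * k - 2 - (d - 2 * k * r) %% (2 * k - 1))%N.

Lemma cut_dist_lt k L d : (0 < k)%N -> (cut_dist k L d < 2 * k)%N.
Proof. by move=> k0; rewrite /cut_dist; case: ifP; lia. Qed.

Lemma cut_dist_0 k L : (2 * k - 2 <= cut_dist k L 0)%N.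
Proof. by rewrite /cut_dist sub0n !mod0n; case: ifP; lia. Qed.

Lemma modnS_eq n d : (0 < n)%N ->
  (d.+1 %% n = if d %% n == n.-1 then 0 else (d %% n).+1)%N.
Proof.
move=> n0; have lt := ltn_pmod d n0; rewrite -addn1 -modnDml.
by case: eqP => [->|ne]; [rewrite addn1 prednK// modnn | rewrite modn_small; lia].
Qed.

Lemma cut_distS k L d : (0 < k)%N ->
  if (0 < cut_dist k L d)%N then cut_dist k L d.+1 = (cut_dist k L d).-1
  else (2 * k - 2 <= cut_dist k L d.+1)%N.
Proof.
move=> k0; rewrite /cut_dist; set r := (L %% _)%N.
have k2 : (0 < 2 * k)%N by lia.
have k1 : (0 < 2 * k - 1)%N by lia.
have [lt|ge] := ltnP d (2 * k * r).
  have mlt := ltn_pmod d k2; have e := modnS_eq d k2.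
  have [lt'|ge'] := ltnP d.+1 (2 * k * r).
    by rewrite e; case: eqP; case: ifP; lia.
  have ed : d.+1 = (2 * k * r)%N by lia.
  (* At the border between long and short pieces, [e] forces [d] to be the last point of a long
     piece, with label 0; the next label is [2k - 2]. *)
  move: e; rewrite ed subnn mod0n modnMr; case: eqP; case: ifP; lia.
have mlt := ltn_pmod (d - 2 * k * r) k1; have e := modnS_eq (d - 2 * k * r) k1.
have -> : (d.+1 < 2 * k * r)%N = false by lia.
by rewrite subSn// e; case: eqP; case: ifP; lia.
Qed.

Lemma cut_dist_last k L : (1 < k)%N -> ((2 * k) ^ 2 <= L)%N ->
  cut_dist k L L.-1 = 0%N.
Proof.
move=> k1 hL; rewrite /cut_dist.
have n0 : (0 < 2 * k - 1)%N by lia.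
have := divn_eq L (2 * k - 1); have := ltn_pmod L n0.
set q := (L %/ _)%N; set r := (L %% _)%N => rlt e.
(* The bound on [L] makes [q] exceed every remainder, so the [r] long and [q - r] short pieces fill
   the interval exactly. *)
have hq : (r <= q)%N by nia.
have [lt|ge] := ltnP L.-1 (2 * k * r).
  have qr : q = r by nia.
  rewrite (_ : L.-1 = r.-1 * (2 * k) + (2 * k - 1))%N; last by nia.
  by rewrite modnMDl modn_small; lia.
rewrite (_ : L.-1 - _ = (q - r).-1 * (2 * k - 1) + (2 * k - 2))%N; last by nia.
by rewrite modnMDl modn_small; lia.
Qed.

(** * Borel sets of configurations *)

Notation config := (int -> bool).

Definition translate (s : int) (x : config) : config := fun h => x (h + s).

Lemma translate0 x : translate 0 x = x.
Proof. by apply/funext => h; rewrite /translate addr0. Qed.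

Lemma translateD s t x : translate s (translate t x) = translate (s + t) x.
Proof. by apply/funext => h; rewrite /translate addrA. Qed.

(* The sigma-algebra generated by the coordinates; being inductive, it makes
   translation invariance and the transfer to the free part immediate. *)
Inductive config_borel : (config -> Prop) -> Prop :=
| config_borel_coord h : config_borel (fun x => x h)
| config_borelC P : config_borel P -> config_borel (fun x => ~ P x)
| config_borel_ex_nat (P : nat -> config -> Prop) :
    (forall n, config_borel (P n)) -> config_borel (fun x => exists n, P n x).

Lemma config_borel_ext (P Q : config -> Prop) :
  (forall x, P x <-> Q x) -> config_borel P -> config_borel Q.
Proof.
by move=> e; have -> : Q = P by apply/funext => x; apply/propext; split=> /e.
Qed.

Lemma config_borel_translate s P :
  config_borel P -> config_borel (fun x => P (translate s x)).
Proof.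
elim=> [h|Q _ IH|Q _ IH]; first exact: (config_borel_coord (h + s)).
  exact: config_borelC IH.
exact: config_borel_ex_nat IH.
Qed.

(** The empty set is obtained as the complement of the union of a coordinate set and its
    complement. *)
Lemma config_borel_False : config_borel (fun=> False).
Proof.
have h := config_borel_coord 0.
apply: (config_borel_ext _ (config_borelC (config_borel_ex_nat
  (P := fun n x => if n is 0%N then x 0 : Prop else ~ x 0) _))).
  move=> x; split=> // h'; apply: h'.
  by case: (pselect (x 0)); [exists 0%N | exists 1%N].
by case=> [|n]; [exact: h | exact: config_borelC].
Qed.

Lemma config_borel_ex (T : countType) (P : T -> config -> Prop) :
  (forall t, config_borel (P t)) -> config_borel (fun x => exists t, P t x).
Proof.
move=> hP; apply: (config_borel_ext _ (config_borel_ex_nat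
  (P := fun n x => if unpickle n is Some t then P t x else False) _)).
  move=> x; split=> [[n]|[t Pt]]; first by case: unpickle => // t; exists t.
  by exists (pickle t); rewrite pickleK.
by move=> n; case: unpickle => [t|]; [exact: hP | exact: config_borel_False].
Qed.

Lemma config_borel_cst (A : Prop) : config_borel (fun=> A).
Proof.
case: (pselect A) => a; last first.
  by apply: (config_borel_ext _ config_borel_False) => x; split.
by apply: (config_borel_ext _ (config_borelC config_borel_False)) => x; split=> // _ [].
Qed.

Lemma config_borel_all (T : countType) (P : T -> config -> Prop) :
  (forall t, config_borel (P t)) -> config_borel (fun x => forall t, P t x).
Proof.
move=> hP; apply: (config_borel_ext _ (config_borelC
  (config_borel_ex (fun t => config_borelC (hP t))))).
move=> x; rewrite -forallNE; split=> h t; last by move=> /(_ (h t)).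
by apply: contrapT; apply: h.
Qed.

Lemma config_borel_and P Q : config_borel P -> config_borel Q ->
  config_borel (fun x => P x /\ Q x).
Proof.
move=> hP hQ; apply: (config_borel_ext _ (config_borel_all
  (P := fun b : bool => if b then P else Q) _)); last by case.
by move=> x; split=> [h|[? ?] []//]; split; [apply: (h true)|apply: (h false)].
Qed.

Lemma config_borel_or P Q : config_borel P -> config_borel Q ->
  config_borel (fun x => P x \/ Q x).
Proof.
move=> hP hQ; apply: (config_borel_ext _ (config_borel_ex
  (P := fun b : bool => if b then P else Q) _)); last by case.
by move=> x; split=> [[[] h]|[h|h]]; [left|right|exists true|exists false].
Qed.

Lemma config_borel_cond (A : Prop) P : config_borel P ->
  config_borel (fun x => A -> P x).
Proof.
move=> hP; case: (pselect A) => a.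
  by apply: (config_borel_ext _ hP) => x; split=> // /(_ a).
by apply: (config_borel_ext _ (config_borel_cst True)) => x; split.
Qed.

(** * Borel marker sets *)

Definition aperiodic (x : config) : Prop :=
  forall s : int, s <> 0 -> translate s x <> x.

Lemma aperiodic_translate s x : aperiodic x -> aperiodic (translate s x).
Proof.
move=> hx t t0 e; apply: (hx t t0); rewrite -[RHS]translate0 -(addNr s).
by rewrite -translateD -e !translateD; congr (translate _ x); lia.
Qed.

(** Patterns are finite lists, hence form a countable type that [unpickle] enumerates. *)
Definition matches (w : seq (int * bool)) (x : config) : Prop :=
  forall p, p \in w -> x p.1 = p.2.

(** Two positions of an orbit at distance between 1 and [N] can never both be separated by the same
    pattern. *)
Definition separated_by (N : nat) (w : seq (int * bool)) (x : config) : Prop :=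
  matches w x /\
  forall n : nat, (0 < n <= N)%N -> ~ matches w (translate n x).

Fixpoint greedy_markers (N i : nat) (x : config) : Prop :=
  if i is i.+1 then
    greedy_markers N i x \/
    ((exists w, unpickle i = Some w /\ separated_by N w x) /\
     forall s : int, (0 < `|s| <= N)%N -> ~ greedy_markers N i (translate s x))
  else False.

Definition marker (N : nat) (x : config) : Prop :=
  exists i, greedy_markers N i x.

(** For each shift [n] up to [N], the pattern records the value of [x] at one position where the
    shifted configuration differs. *)
Lemma aperiodic_separated N x :
  aperiodic x -> exists w, separated_by N w x.
Proof.
move=> hx.
have /choice[f hf] : forall n : nat, exists h : int,
    (0 < n)%N -> translate n x h <> x h.
  move=> n; apply: contrapT => /forallNP h.
  have n0 : (0 < n)%N by apply: contrapT => n0; apply: (h 0).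
  apply: (hx n%:Z); first by lia.
  by apply/funext => i; apply: contrapT => ne; apply: (h i).
exists [seq (f n, x (f n)) | n <- iota 1 N]; split.
  by move=> p /mapP[n _ ->].
move=> n hn h; apply: (hf n); first by lia.
by apply: (h (f n, x (f n))); apply/mapP; exists n => //; rewrite mem_iota; lia.
Qed.

Lemma greedy_markers_mono N i j x :
  (i <= j)%N -> greedy_markers N i x -> greedy_markers N j x.
Proof.
move=> ij; elim: j ij => [|j IH]; first by rewrite leqn0 => /eqP ->.
by rewrite leq_eqVlt => /predU1P[->//|ij] hi; left; apply: IH.
Qed.

(** Two earlier markers are handled by induction, a new one avoids the earlier ones by construction,
    and two new ones would share the pattern of code [i]. *)
Lemma greedy_markers_discrete N i x (n : nat) : (0 < n <= N)%N ->
  greedy_markers N i x -> ~ greedy_markers N i (translate n x).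
Proof.
move=> hn; elim: i => [|i IH]//= [hx|[[w [ew [_ hw]]] hx]].
  case=> [|[_ /(_ (- n%:Z))]]; first exact: IH.
  by rewrite translateD addNr translate0; apply=> //; lia.
case=> [|[[v [ev [hv _]]] _]]; first by apply: hx; lia.
by apply: (hw n hn); move: ev; rewrite ew => -[->].
Qed.

Lemma marker_discrete N x (n : nat) : (0 < n <= N)%N ->
  marker N x -> ~ marker N (translate n x).
Proof.
move=> hn [i hi] [j hj]; apply: (@greedy_markers_discrete N (maxn i j) x n hn).
  exact: greedy_markers_mono (leq_maxl _ _) hi.
exact: greedy_markers_mono (leq_maxr _ _) hj.
Qed.

(** Let [w] separate [x]. When the turn of [w] comes, either a marker already lies within [N], or
    the origin itself is added. *)
Lemma marker_maximal N x : aperiodic x ->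
  exists2 s : int, (`|s| <= N)%N & marker N (translate s x).
Proof.
move=> /(aperiodic_separated N)[w hw].
case: (pselect (exists2 s : int, (0 < `|s| <= N)%N &
    greedy_markers N (pickle w) (translate s x))) => [[s hs hg]|ne].
  by exists s; [lia | exists (pickle w)].
exists 0 => //; exists (pickle w).+1; right; rewrite translate0; split.
  by exists w; rewrite pickleK.
by move=> s hs hg; apply: ne; exists s.
Qed.

Lemma separated_by_borel N w : config_borel (separated_by N w).
Proof.
have mb : config_borel (matches w).
  apply: config_borel_all => p; apply: config_borel_cond.
  have hp := config_borel_coord p.1.
  case: p.2; first exact: hp.
  by apply: (config_borel_ext _ (config_borelC hp)) => x; split=> [/negP/negbTE|->].
apply: config_borel_and => //; apply: config_borel_all => n.
apply/config_borel_cond/config_borelC.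
exact: (config_borel_translate n%:Z mb).
Qed.

Lemma marker_borel N : config_borel (marker N).
Proof.
apply: config_borel_ex => i; elim: i => [|i IH] /=.
  exact: config_borel_False.
apply: config_borel_or => //; apply: config_borel_and.
  apply: config_borel_ex => w.
  case: (pselect (unpickle i = Some w)) => e.
    by apply: (config_borel_ext _ (separated_by_borel N w)) => x; split=> [|[]].
  by apply: (config_borel_ext _ config_borel_False) => x; split=> [|[]].
apply: config_borel_all => s; apply/config_borel_cond/config_borelC.
exact: config_borel_translate.
Qed.

(* The origin of [x] lies in a gap between consecutive markers, [d] steps after
   its left end and [e > 0] steps before its right end. *)
Definition marker_gap (N : nat) (x : config) (d e : nat) : Prop :=
  [/\ marker N (translate (- d%:Z) x), marker N (translate e x), (0 < e)%N &
      forall s : int, - d%:Z < s < e%:Z -> ~ marker N (translate s x)].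

Lemma marker_gap_borel N d e : config_borel (fun x => marker_gap N x d e).
Proof.
have mb s := config_borel_translate s (marker_borel N).
have h : config_borel (fun x => (marker N (translate (- d%:Z) x) /\
    marker N (translate e x)) /\ (~ (e = 0)%N /\
    forall s : int, - d%:Z < s < e%:Z -> ~ marker N (translate s x))).
  apply: config_borel_and; first exact: config_borel_and.
  apply: config_borel_and.
    by apply/config_borelC/config_borel_cst.
  by apply: config_borel_all => s; apply/config_borel_cond/config_borelC.
apply: (config_borel_ext _ h) => x; split=> [[[? ?] [? ?]]|[? ? ? ?]].
  by split=> //; lia.
by split=> //; split=> //; lia.
Qed.

(** If two ends differed, the nearer one would be a marker strictly inside the other gap. *)
Lemma marker_gap_unique N x d e d' e' :
  marker_gap N x d e -> marker_gap N x d' e' -> d = d' /\ e = e'.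
Proof.
move=> [md me e0 h] [md' me' e0' h']; split; apply: contrapT => ne.
  have [lt|ge] := ltnP d d'; first by apply: (h' _ _ md); lia.
  by apply: (h _ _ md'); lia.
have [lt|ge] := ltnP e e'; first by apply: (h' _ _ me); lia.
by apply: (h _ _ me'); lia.
Qed.

Lemma marker_gap_long N x d e : marker_gap N x d e -> (N < d + e)%N.
Proof.
move=> [md me e0 _]; rewrite ltnNge; apply/negP => le.
apply: (@marker_discrete N (translate (- d%:Z) x) (d + e)%N) => //; first by lia.
by rewrite translateD (_ : (d + e)%:Z - d%:Z = e%:Z)//; lia.
Qed.

Lemma marker_gap_exists N x : aperiodic x -> exists d e, marker_gap N x d e.
Proof.
move=> hx.
have exd : exists d : nat, `[< marker N (translate (- d%:Z) x) >].
  (* The window of radius [N] around [-N] contains no positive position; the one around [N + 1]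
     below contains only positive ones. *)
  have [s hs hm] := marker_maximal N (aperiodic_translate (s := - N%:Z) hx).
  exists `|s - N%:Z|%N; apply/asboolP; move: hm; rewrite translateD.
  by rewrite (_ : - (`|s - N%:Z|%N)%:Z = s - N%:Z)//; lia.
have exe : exists e : nat, `[< marker N (translate e.+1 x) >].
  have [s hs hm] := marker_maximal N (aperiodic_translate (s := N%:Z + 1) hx).
  exists `|(s + N%:Z)%R|%N; apply/asboolP; move: hm; rewrite translateD.
  by rewrite (_ : (`|(s + N%:Z)%R|%N.+1)%:Z = s + (N%:Z + 1))//; lia.
case: (ex_minnP exd) => d /asboolP md mind.
case: (ex_minnP exe) => e /asboolP me mine.
exists d, e.+1; split=> // s hs ms.
have [s0|s0] := lerP s 0.
  have /mind : `[< marker N (translate (- `|s|%N%:Z) x) >]; last by lia.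
  by apply/asboolP; rewrite (_ : - `|s|%N%:Z = s)//; lia.
have /mine : `[< marker N (translate `|s|.-1.+1 x) >]; last by lia.
by apply/asboolP; rewrite (_ : `|s|.-1.+1%:Z = s)//; lia.
Qed.

Lemma marker_gapS N x d e :
  marker_gap N x d e.+2 -> marker_gap N (translate 1 x) d.+1 e.+1.
Proof.
move=> [md me e0 h]; split=> //.
- by rewrite translateD (_ : - d.+1%:Z + 1 = - d%:Z)//; lia.
- by rewrite translateD (_ : e.+1%:Z + 1 = e.+2%:Z)//; lia.
- by move=> s hs; rewrite translateD; apply: h; lia.
Qed.

Lemma marker_gap_next N x d d' e' : marker_gap N x d 1 ->
  marker_gap N (translate 1 x) d' e' -> d' = 0%N.
Proof.
move=> [_ me _ _] [_ _ e0 h]; case: d' h => // d' /(_ 0).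
by rewrite translate0 => h; case: h => //; lia.
Qed.

(** * The coloring of the free part *)

(* Any gap length above [(2k)^2] can be cut into pieces of lengths [2k] and
   [2k-1]. *)
Definition color_rel (k : nat) (x : config) (n : nat) : Prop :=
  exists d e, marker_gap ((2 * k) ^ 2) x d e /\ n = cut_dist k (d + e) d.

(** Inside a gap the length [d + e] stays fixed and the cut counts down. At the last point ([e = 1])
    the cut ends with label 0 and the next gap opens a new piece. *)
Lemma color_rel_step k x a b : (1 < k)%N ->
  color_rel k x a -> color_rel k (translate 1 x) b ->
  if (0 < a)%N then b = a.-1 else (2 * k - 2 <= b)%N.
Proof.
move=> k1 [d [e [g ->]]] [d' [e' [g' ->]]].
case: e g => [[]//|[|e]] g.
  rewrite (marker_gap_next g g') {2}(_ : d = (d + 1).-1); last by lia.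
  rewrite cut_dist_last//; first exact: cut_dist_0.
  exact/ltnW/marker_gap_long/g.
have [<- <-] := marker_gap_unique (marker_gapS g) g'.
by rewrite addSnnS; apply: cut_distS; lia.
Qed.

Lemma color_rel_total k x : aperiodic x -> exists n, color_rel k x n.
Proof.
move=> hx; have [d [e g]] := marker_gap_exists ((2 * k) ^ 2) hx.
by exists (cut_dist k (d + e) d), d, e.
Qed.

Lemma color_rel_fun k x a b : color_rel k x a -> color_rel k x b -> a = b.
Proof.
by move=> [d [e [g ->]]] [d' [e' [g' ->]]]; have [-> ->] := marker_gap_unique g g'.
Qed.

Lemma color_rel_lt k x n : (0 < k)%N -> color_rel k x n -> (n < 2 * k)%N.
Proof. by move=> k0 [d [e [_ ->]]]; exact: cut_dist_lt. Qed.

Lemma color_rel_borel k n : config_borel (fun x => color_rel k x n).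
Proof.
apply: config_borel_ex => d; apply: config_borel_ex => e.
by apply: config_borel_and; [exact: marker_gap_borel | exact: config_borel_cst].
Qed.

Lemma color_rel_half_neq k x (j : nat) a b : (1 < k)%N -> aperiodic x ->
  (2 <= j <= 2 * k - 3)%N ->
  color_rel k x a -> color_rel k (translate j x) b -> a./2 <> b./2.
Proof.
move=> k1 hx hj ha hb.
(* The labels along the orbit of [x] form a countdown on the integers. *)
have /choice[g hg] : forall i, exists n, color_rel k (translate i x) n.
  by move=> i; apply/color_rel_total/aperiodic_translate.
have cg : countdown k g.
  move=> i; apply: (color_rel_step k1 (hg i)).
  by rewrite translateD [1 + i]addrC.
have -> : a = g 0 by apply: (color_rel_fun ha); have := hg 0; rewrite translate0.
rewrite (color_rel_fun hb (hg j)) -[X in g X]add0r.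
exact: countdown_half_neq cg _ _ hj.
Qed.

(** * Transfer to the shift graph *)

Local Open Scope classical_set_scope.

Lemma shiftE (s : int) (x : config) : @shift Zgrp s x = translate (- s) x.
Proof. by apply/funext => h; rewrite /translate [h + _]addrC. Qed.

Lemma free_part_aperiodic (x : free_part Zgrp) : aperiodic (set_val x).
Proof.
move=> s s0 e; have /set_mem hx := valP x; apply: (hx (- s)).
  by move=> /(congr1 (fun t : int => - t)); rewrite opprK => /s0.
by rewrite shiftE opprK.
Qed.

(** Topology enters only for coordinate sets, which are open because evaluation is continuous on the
    subspace. *)
Lemma config_borel_borel_set (P : config -> Prop) : config_borel P ->
  borel_set [set x : free_part Zgrp | P (set_val x)].
Proof.
elim=> [h|Q _ IH|Q _ IH].
- apply: sub_sigma_algebra.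
  rewrite (_ : [set _ | _] = (fun x : free_part Zgrp =>
    proj (h : Zgrp) (set_val x)) @^-1` [set true]); last by apply/seteqP; split.
  apply: open_comp; last exact: discrete_open.
  move=> x _; apply: continuous_comp; first exact: initial_continuous.
  exact: proj_continuous.
- by have := sigma_algebraCD IH; rewrite setTD.
- rewrite (_ : [set _ | _] = \bigcup_n [set x : free_part Zgrp | Q n (set_val x)]).
    exact: sigma_algebra_bigcup.
  by apply/seteqP; split=> [x [n Qn]|x [n _ Qn]]; exists n.
Qed.

(** Indicators of single integers form one explicit free orbit, on which the lower bound is
    tested. *)
Definition single_config (i : int) : {ptws Zgrp -> bool} :=
  fun h : int => h == i.

Lemma shift_single s i :
  @shift Zgrp s (single_config i) = single_config (i + s).
Proof.
apply/funext => h; rewrite shiftE /translate /single_config.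
by apply/eqP/eqP; lia.
Qed.

Lemma single_config_inj : injective single_config.
Proof.
by move=> i j /(congr1 (fun x => x i)); rewrite /single_config eqxx => /esym/eqP.
Qed.

Lemma single_config_free i : single_config i \in free_part Zgrp.
Proof.
apply/mem_set => s s0; rewrite shift_single => /single_config_inj e.
by apply: s0; change (s = 0 :> int); lia.
Qed.

Lemma shift_graph_colorable k (hk : (3 <= k)%N) :
  borel_colorable (shift_graph (Gamma' hk)) k.
Proof.
have /choice[f hf] : forall x : free_part Zgrp, exists n, color_rel k (set_val x) n.
  by move=> x; apply/color_rel_total/free_part_aperiodic.
have fk x : ((f x)./2 < k)%N.
  by have := color_rel_lt _ (hf x); lia.
exists (fun x => Ordinal (fk x)); split=> [A|].
  pose P x := exists n, color_rel k x n /\ exists2 c, A c & n./2 = c :> nat.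
  rewrite (_ : _ @^-1` _ = [set x : free_part Zgrp | P (set_val x)]).
    apply: (@config_borel_borel_set P); apply: config_borel_ex => n.
    by apply: config_borel_and; [exact: color_rel_borel | exact: config_borel_cst].
  apply/seteqP; split=> x /=.
    by move=> Ax; exists (f x); split=> //; exists (Ordinal (fk x)).
  move=> [n [hn [c Ac nc]]]; suff -> : Ordinal (fk x) = c by [].
  by apply/val_inj; rewrite /= (color_rel_fun (hf x) hn).
have neq (x y : free_part Zgrp) (s : int) : 2 <= s <= 2 * k%:Z - 3 ->
    translate s (set_val x) = set_val y -> (f x)./2 <> (f y)./2.
  case: s => // s hs exy; have := hf y; rewrite -exy.
  apply: color_rel_half_neq (hf x); [lia | exact: free_part_aperiodic | lia].
move=> x y [_ [s /andP[s2 sk]]]; rewrite shiftE => exy /(congr1 val)/=.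
have [s0|s0] := lerP (s : int) 0.
  by apply: (neq _ _ (- s)) => //; lia.
(* As [shift s] translates by [-s], a positive [s] makes [x] the forward translate of [y], so the
   roles swap. *)
move=> /esym; apply: (neq _ _ s); first by lia.
by rewrite -exy translateD subrr translate0.
Qed.

Lemma shift_graph_colors_ge k (hk : (3 <= k)%N) m :
  borel_colorable (shift_graph (Gamma' hk)) m -> (k <= m)%N.
Proof.
move=> [c [_ hc]].
pose v i : free_part Zgrp :=
  exist (fun x => x \in free_part Zgrp) _ (single_config_free i).
apply: (@coloring_size_ge k m (fun i => c (v i)) hk) => i j hij.
apply: hc; split.
  by move=> /(congr1 set_val)/single_config_inj; lia.
exists (j - i : int); first by rewrite /= /Gamma'_gens /=; lia.
by rewrite /= shift_single addrC subrK.
Qed.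

Theorem theorem6 (k : nat) (hk : (3 <= k)%N) :
  borel_chromatic_number (shift_graph (Gamma' hk)) k.
Proof.
by split=> [|m]; [exact: shift_graph_colorable | exact: shift_graph_colors_ge].
Qed.
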